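(* Let $D \subset \mathbb R^n$ be an open convex set, and let $K = \{ (t,x) \in \mathbb R\times\mathbb R^{n} \mid t > 0,\ t^{-1}x \in D \}$ be its conic extension. Let $f: D \to \mathbb R$ be a $C^3$ function, let $\nu \geq 2$ be a real number, and define $F: K \to \mathbb R$ by $F(t,x) = \nu(-\log t + f(t^{-1}x))$. Set $\gamma = \frac{\nu - 2}{\sqrt{\nu-1}}$. Then the following are equivalent: (i) for all $x \in D$ the matrix $f''(x) - f'(x)f'(x)^T$ is positive definite, and for all $x \in D$, $h \in \mathbb R^n$, \[ |f'''(x)[h,h,h] - 6f''(x)[h,h]\,f'(x)[h] + 4(f'(x)[h])^3| \leq 2\gamma\left(f''(x)[h,h] - (f'(x)[h])^2\right)^{3/2}; \] (ii) for all $z \in K$ the Hessian $F''(z)$ is positive definite, and for all $z \in K$, $h \in \mathbb R^{n+1}$, \[ |F'''(z)[h,h,h]| \leq 2(F''(z)[h,h])^{3/2}. \]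
   Context: $f'(x)$, $f''(x)$, $f'''(x)$ denote the gradient (column vector / linear form), Hessian (bilinear form) and third derivative (trilinear form) of $f$ at $x$; $f'(x)[h]$, $f''(x)[h,h]$, $f'''(x)[h,h,h]$ denote their values on the vector $h$. Similarly for $F$. In the paper's terminology, (i) says that $f$ satisfies the conditions (1) and (3) of projective self-concordance with parameter $\gamma$ and (ii) says that $F$ satisfies the conditions (1) and (3) of (affine) self-concordance. *)

(* Defs.v *)
From mathcomp Require Import all_boot all_order all_algebra.
From mathcomp Require Import all_classical all_reals all_analysis.

Set Implicit Arguments.
Unset Strict Implicit.
Unset Printing Implicit Defensive.

Import Order.TTheory GRing.Theory Num.Theory.
Import numFieldNormedType.Exports.

Local Open Scope classical_set_scope.
Local Open Scope ring_scope.

(* A function defined on an open set [D] is represented by a total function.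
   All the notions below only depend on its germ at the points considered,
   so the values outside [D] are irrelevant. *)

Definition partial (R : realType) (n : nat) (i : 'I_n) (f : 'cV[R]_n -> R)
    (x : 'cV[R]_n) : R :=
  'D_(delta_mx i 0) f x.

(* [f] is of class C^k on the open set [D]: all its iterated partial
   derivatives of order at most [k] exist on [D] and are continuous there. *)
Fixpoint Ck_on (R : realType) (n : nat) (k : nat) (D : set 'cV[R]_n)
    (f : 'cV[R]_n -> R) : Prop :=
  (forall x, D x -> {for x, continuous f}) /\
  (if k is k'.+1 then
     forall i : 'I_n,
       (forall x, D x -> derivable f x (delta_mx i 0)) /\
       Ck_on k' D (partial i f)
   else True).

Definition gradient (R : realType) (n : nat) (f : 'cV[R]_n -> R)
    (x : 'cV[R]_n) : 'cV[R]_n :=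
  \col_i partial i f x.

Definition hessian (R : realType) (n : nat) (f : 'cV[R]_n -> R)
    (x : 'cV[R]_n) : 'M[R]_n :=
  \matrix_(i, j) partial i (partial j f) x.

(* The derivatives of [f] at [x] as a linear, a bilinear and a trilinear form. *)

Definition deriv_form1 (R : realType) (n : nat) (f : 'cV[R]_n -> R)
    (x u : 'cV[R]_n) : R :=
  ((gradient f x)^T *m u) 0 0.

Definition deriv_form2 (R : realType) (n : nat) (f : 'cV[R]_n -> R)
    (x u v : 'cV[R]_n) : R :=
  (u^T *m hessian f x *m v) 0 0.

Definition deriv_form3 (R : realType) (n : nat) (f : 'cV[R]_n -> R)
    (x u v w : 'cV[R]_n) : R :=
  \sum_i \sum_j \sum_k
    partial i (partial j (partial k f)) x * u i 0 * v j 0 * w k 0.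

Definition posdefmx (R : realType) (n : nat) (A : 'M[R]_n) : Prop :=
  A^T = A /\ forall h : 'cV[R]_n, h != 0 -> 0 < (h^T *m A *m h) 0 0.

(* A point (t, x) of R x R^n is the column vector of size 1 + n whose first
   entry is t and whose last n entries form x. *)

Definition cone_t (R : realType) (n : nat) (z : 'cV[R]_(1 + n)) : R :=
  usubmx z 0 0.

Definition cone_x (R : realType) (n : nat) (z : 'cV[R]_(1 + n)) : 'cV[R]_n :=
  dsubmx z.

Definition conic_extension (R : realType) (n : nat) (D : set 'cV[R]_n) :
    set 'cV[R]_(1 + n) :=
  [set z | 0 < cone_t z /\ D ((cone_t z)^-1 *: cone_x z)].

Definition conic_barrier (R : realType) (n : nat) (nu : R)
    (f : 'cV[R]_n -> R) (z : 'cV[R]_(1 + n)) : R :=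
  nu * (- ln (cone_t z) + f ((cone_t z)^-1 *: cone_x z)).

(* Main.v *)
(* Fix z = (t, x) and h = (tau, xi), and put y = x / t, a = tau / t and
   w = (xi - tau y) / t.  Since (x + s xi) / (t + s tau) = y + s / (1 + a s) w,
   the restriction of F to the line z + s h is, up to a constant,
   nu (- ln (1 + a s) + f (y + s / (1 + a s) w)).
   With p = f'(y)[w], b = a - p, Delta = f''(y)[w,w] - p^2 and
   T = f'''(y)[w,w,w] - 6 f''(y)[w,w] p + 4 p^3, differentiating gives
     F''(z)[h,h] = nu (b^2 + Delta),
     F'''(z)[h,h,h] = nu (T - 6 b Delta - 2 b^3),
   where w and b can be prescribed arbitrarily.  The theorem thus amounts to the
   scalar fact that |T| <= 2 gamma Delta^(3/2) if and only if
   |T - 6 b Delta - 2 b^3| <= 2 sqrt nu (b^2 + Delta)^(3/2) for all b, the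
   extremal choice being b = +- sqrt (Delta / (nu - 1)). *)

Require Import Defs.
From mathcomp Require Import all_boot all_order all_algebra.
From mathcomp Require Import all_classical all_reals all_analysis.
From mathcomp Require Import ring lra.

Set Implicit Arguments.
Unset Strict Implicit.
Unset Printing Implicit Defensive.

Import Order.TTheory GRing.Theory Num.Theory.
Import numFieldNormedType.Exports.

Local Open Scope classical_set_scope.
Local Open Scope ring_scope.

(** * Directional derivatives *)

(** The two difference quotients are the same function of the increment. This reduces directional
    derivatives to derivatives of one real variable, where the chain rule and the mean value theorem
    are available. *)
Lemma is_derive_lineP (R : realType) (V : normedModType R) (f : V -> R)
    (z h : V) (s d : R) :
  is_derive (z + s *: h) h f d <->
  is_derive s (1 : R) (fun r => f (z + r *: h)) d.
Proof.
have E : (fun r : R => r^-1 *: ((f \o shift (z + s *: h)) (r *: h)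
             - f (z + s *: h))) =
         (fun r : R => r^-1 *: (((fun r => f (z + r *: h)) \o shift s) (r *: 1)
             - f (z + s *: h))).
  by apply/funext => r /=; rewrite scalerDl [_%:A]mulr1 addrCA.
split=> -[fd fE]; split.
- by move: fd; rewrite /derivable E.
- by move: fE; rewrite /derive E.
- by move: fd; rewrite /derivable E.
- by move: fE; rewrite /derive E.
Qed.

Lemma is_derive_line0P (R : realType) (V : normedModType R) (f : V -> R)
    (z h : V) (d : R) :
  is_derive z h f d <->
  is_derive (0 : R) (1 : R) (fun r : R => f (z + r *: h)) d.
Proof. by rewrite -is_derive_lineP scale0r addr0. Qed.

Lemma is_derive_scaledir (R : realType) (V : normedModType R) (f : V -> R)
    (z h : V) (c d : R) :
  is_derive z h f d -> is_derive z (c *: h) f (c * d).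
Proof.
move=> fd; apply/is_derive_line0P.
have -> : (fun r : R => f (z + r *: (c *: h))) =
          (fun r => f (z + r *: h)) \o (fun r => r * c).
  by apply/funext => r /=; rewrite scalerA.
rewrite mulrC; apply: is_derive1_comp.
  by rewrite mul0r; move/is_derive_line0P: fd.
have -> : (fun r : R => r * c) = c *: (id : R -> R).
  by apply/funext => r; rewrite mulrC.
by apply: is_derive_eq; rewrite [LHS]mulr1.
Qed.

Lemma is_derive_translate (R : realType) (V : normedModType R) (f : V -> R)
    (z a h : V) (d : R) :
  is_derive (z + a) h f d -> is_derive z h (fun y => f (y + a)) d.
Proof.
move=> /is_derive_line0P fd; apply/is_derive_line0P.
by under eq_fun do rewrite addrAC.
Qed.

(** The one-variable mean value theorem on [[0, 1]] for [r] mapped to [f (y + r *: e)]. Stating it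
    as closeness to a fixed [L] gives error bounds uniform in the base point [y]. *)
Lemma mean_value_bound (R : realType) (V : normedModType R) (f df : V -> R)
    (y e : V) (L eta : R) :
  (forall r : R, 0 <= r <= 1 -> is_derive (y + r *: e) e f (df (y + r *: e))) ->
  (forall r : R, 0 <= r <= 1 -> `|df (y + r *: e) - L| <= eta) ->
  `|f (y + e) - f y - L| <= eta.
Proof.
move=> fdf dfL.
pose g (r : R) := f (y + r *: e).
have gd (r : R) : r \in `[0, 1] -> is_derive r (1 : R) g (df (y + r *: e)).
  by rewrite in_itv /= => /fdf/is_derive_lineP.
have gd' (r : R) : r \in `]0, 1[%R -> is_derive r (1 : R) g (df (y + r *: e)).
  by move=> r01; apply: gd; apply: subset_itv_oo_cc.
have gc : {within `[0, 1], continuous g}.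
  by apply: derivable_within_continuous => r /gd[].
have [c] := MVT_segment (@ler01 R) gd' gc.
rewrite in_itv /= => c01.
by rewrite /g scale1r scale0r addr0 subr0 mulr1 => ->; apply: dfL.
Qed.

(* The increment along [s *: (u + c *: e)] is split at [x + s *: u]; the mean
   value theorem controls the second leg uniformly in its starting point. *)
Lemma is_derive_addr (R : realType) (V : normedModType R) (f : V -> R)
    (x u e : V) (a c : R) :
  is_derive x u f a -> (\forall y \near x, derivable f y e) ->
  {for x, continuous ('D_e f)} ->
  is_derive x (u + c *: e) f (a + c * 'D_e f x).
Proof.
move=> [fu fuE] fe ce.
suff lim2 : (fun s : R => s^-1 *: (f (s *: (u + c *: e) + x) - f (s *: u + x)))
    @ 0^' --> c * 'D_e f x.
  have lim1 : (fun s : R => s^-1 *: ((f \o shift x) (s *: u) - f x))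
    @ 0^' --> a by rewrite -fuE; exact: fu.
  have lim : (fun s : R => s^-1 *: ((f \o shift x) (s *: (u + c *: e)) - f x))
    @ 0^' --> a + c * 'D_e f x.
    apply: cvg_trans (cvgD lim1 lim2).
    apply: near_eq_cvg; near=> s => /=.
    rewrite fctE -scalerDr; congr (_ *: _).
    by rewrite /= addrC addrA subrK.
  by split; [apply/cvg_ex; exists (a + c * 'D_e f x)|apply/cvg_lim].
apply/cvgrPdist_le => /= eps eps0.
(* The tolerance [eps / N] absorbs the factor [|c|] of the second leg; the summand 1 keeps [N]
   positive when [c] is 0. *)
set N := 1 + `|c|.
have N0 : 0 < N by rewrite ltr_pwDl.
have /nbhs_ballP[r /= r0 Hr] : \forall y \near x,
    derivable f y e /\ `|'D_e f x - 'D_e f y| <= eps / N.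
  apply: filterI => //.
  by have /cvgrPdist_le := ce; apply; rewrite divr_gt0.
set M := 1 + (`|u| + `|c *: e|).
have M0 : 0 < M by rewrite ltr_pwDl // addr_ge0.
near=> s.
have sN0 : s != 0 by near: s; exact: nbhs_dnbhs_neq.
have sM : `|s| * M < r.
  rewrite -ltr_pdivlMr //; near: s.
  by apply: dnbhs0_lt; rewrite divr_gt0.
(* The whole second leg stays in the ball where ['D_e f] is within [eps / N] of its value at [x]. *)
have inball (t : R) : 0 <= t <= 1 ->
    ball x r ((s *: u + x) + t *: ((s * c) *: e)).
  move=> /andP[t0 t1]; rewrite -ball_normE /=.
  have -> : x - (s *: u + x + t *: (s * c *: e)) = - (s *: (u + t *: (c *: e))).
    rewrite scalerDr !scalerA (_ : t * (s * c) = s * (t * c)); last by ring.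
    by rewrite [s *: u + x]addrC -[x + _ + _]addrA opprD addNKr mulrA.
  rewrite normrN normrZ; apply: le_lt_trans sM; rewrite ler_wpM2l //.
  apply: (le_trans (ler_normD _ _)); rewrite /M normrZ (ger0_norm t0).
  have := ler_wpM2r (normr_ge0 (c *: e)) t1; rewrite mul1r; lra.
have := @mean_value_bound R V f (fun y => s * c * 'D_e f y) (s *: u + x)
  ((s * c) *: e) (s * c * 'D_e f x) (`|s| * eps) _ _.
have -> : s *: u + x + (s * c) *: e = s *: (u + c *: e) + x.
  by rewrite scalerDr scalerA addrAC.
move=> H.
set W := f _ - f _ in H *.
have -> : c * 'D_e f x - s^-1 *: W = - (s^-1 * (W - s * c * 'D_e f x)).
  by rewrite mulrBr -(mulrA s) mulKf // opprB.
rewrite normrN normrM normfV ler_pdivrMl ?normr_gt0 //.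
apply: H => t t01.
  by apply: is_derive_scaledir; apply: derivableP;
     have [] := Hr _ (inball _ t01).
have [_] := Hr _ (inball _ t01); rewrite distrC => Ht.
rewrite -mulrBr !normrM -mulrA ler_wpM2l //.
apply: (le_trans (ler_wpM2l (normr_ge0 c) Ht)).
rewrite mulrA ler_pdivrMr // mulrC ler_wpM2l ?ltW // /N; lra.
Unshelve. all: by end_near. Qed.

(** The second difference is the increment along [s *: e1] of the function [f (y + s *: e2) - f y].
    The mean value bound is applied to that function, and then to ['D_e1 f] along [s *: e2]. *)
Lemma second_difference_bound (R : realType) (V : normedModType R)
    (f : V -> R) (x e1 e2 : V) (eta : R) :
  (\forall y \near x, derivable f y e1) ->
  (\forall y \near x, derivable ('D_e1 f) y e2) ->
  {for x, continuous ('D_e2 ('D_e1 f))} -> 0 < eta ->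
  \forall s \near (0 : R),
    `|f (x + s *: e1 + s *: e2) - f (x + s *: e1) - (f (x + s *: e2) - f x)
      - s * (s * 'D_e2 ('D_e1 f) x)| <= `|s| * (`|s| * eta).
Proof.
move=> f1 f12 c12 eta0; set L := 'D_e2 ('D_e1 f) x.
have c12' : \forall y \near x, `|L - 'D_e2 ('D_e1 f) y| <= eta.
  by have /cvgrPdist_le := c12; apply.
have /nbhs_ballP[r /= r0 Hr] : \forall y \near x, [/\ derivable f y e1,
    derivable ('D_e1 f) y e2 & `|L - 'D_e2 ('D_e1 f) y| <= eta].
  by apply: filterS3 f1 f12 c12' => y; split.
set M := 1 + (`|e1| + `|e2|).
have M0 : 0 < M by rewrite ltr_pwDl // addr_ge0.
near=> s.
have sM : `|s| * M < r.
  rewrite -ltr_pdivlMr //; near: s.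
  by apply: cvgr0_norm_lt; rewrite ?divr_gt0 //; exact: cvg_id.
have inball (a b : R) : 0 <= a <= 1 -> 0 <= b <= 1 ->
    ball x r (x + a *: (s *: e1) + b *: (s *: e2)).
  move=> /andP[a0 a1] /andP[b0 b1]; rewrite -ball_normE /= -addrA opprD addNKr.
  rewrite normrN; apply: le_lt_trans sM; apply: (le_trans (ler_normD _ _)).
  rewrite !normrZ (ger0_norm a0) (ger0_norm b0) /M !mulrDr.
  have := ler_wpM2r (mulr_ge0 (normr_ge0 s) (normr_ge0 e1)) a1.
  have := ler_wpM2r (mulr_ge0 (normr_ge0 s) (normr_ge0 e2)) b1.
  by have := normr_ge0 s; lra.
have I0 : 0 <= (0 : R) <= 1 by rewrite lexx ler01.
have I1 : 0 <= (1 : R) <= 1 by rewrite lexx ler01.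
pose u y := f (y + s *: e2) - f y.
apply: (@mean_value_bound R V u
  (fun y => s * 'D_e1 f (y + s *: e2) - s * 'D_e1 f y)) => a a01.
  have := inball a 1 a01 I1; rewrite scale1r => /Hr[f1a _ _].
  have := inball a 0 a01 I0; rewrite scale0r addr0 => /Hr[f1b _ _].
  apply: is_deriveB; apply: is_derive_scaledir; last exact: (derivableP f1b).
  exact: is_derive_translate (derivableP f1a).
rewrite -!mulrBr normrM ler_wpM2l //.
apply: (@mean_value_bound R V ('D_e1 f)
  (fun y => s * 'D_e2 ('D_e1 f) y)) => b b01;
  have [_ d2 dL] := Hr _ (inball _ _ a01 b01).
  exact: is_derive_scaledir (derivableP d2).
rewrite -mulrBr normrM; apply: (ler_wpM2l (normr_ge0 s)).
by rewrite distrC; exact: dL.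
Unshelve. all: by end_near. Qed.

(* Schwarz's theorem: both mixed derivatives are limits of the same second
   difference quotient. *)
Lemma derive_comm (R : realType) (V : normedModType R) (f : V -> R)
    (x e1 e2 : V) :
  (\forall y \near x, derivable f y e1) ->
  (\forall y \near x, derivable f y e2) ->
  (\forall y \near x, derivable ('D_e1 f) y e2) ->
  (\forall y \near x, derivable ('D_e2 f) y e1) ->
  {for x, continuous ('D_e2 ('D_e1 f))} ->
  {for x, continuous ('D_e1 ('D_e2 f))} ->
  'D_e2 ('D_e1 f) x = 'D_e1 ('D_e2 f) x.
Proof.
move=> f1 f2 f12 f21 c12 c21.
apply/eqP; rewrite -subr_eq0 -normr_le0; apply/ler_addgt0Pr => eta eta0.
rewrite add0r.
have eta2 : 0 < eta / 2 by rewrite divr_gt0.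
have B12 := second_difference_bound f1 f12 c12 eta2.
have B21 := second_difference_bound f2 f21 c21 eta2.
(* A single nonzero [s] satisfying both bounds suffices: each contributes [eta / 2], and the common
   factor [|s|^2] is then cancelled. *)
have B0 := @filterI _ (0 : R)^' _ _ _ (nbhs_dnbhs_neq (0 : R))
  (nbhs_dnbhs (@filterI _ _ (nbhs_filter (0 : R)) _ _ B12 B21)).
have [s [/= s0 [/=]]] := filter_ex (B0 _).
rewrite [x + s *: e2 + _]addrAC.
set A := 'D_e2 ('D_e1 f) x; set B := 'D_e1 ('D_e2 f) x.
set p := f _; set q := f _; set q' := f _; set p' := f _ => -[H1 H2].
have : `|s * (s * (A - B))| <= `|s| * (`|s| * eta).
  have -> : s * (s * (A - B)) = (p - q' - (q - p') - s * (s * B)) -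
     (p - q - (q' - p') - s * (s * A)) by ring.
  apply: (le_trans (ler_normB _ _)); apply: (le_trans (lerD H2 H1)).
  by rewrite -mulrDr -mulrDr -splitr.
by rewrite !normrM !ler_pM2l ?normr_gt0.
Qed.

(** * Functions of class C^k *)

Section Ck_basics.
Context {R : realType} {n : nat}.
Implicit Types (D : set 'cV[R]_n) (f g : 'cV[R]_n -> R) (x u v w : 'cV[R]_n).

Lemma Ck_on_continuous k D f x :
  Ck_on k D f -> D x -> {for x, continuous f}.
Proof. by case: k => [|k] [fc _]; exact: fc. Qed.

Lemma Ck_on_derivable k D f x (i : 'I_n) :
  Ck_on k.+1 D f -> D x -> derivable f x (delta_mx i 0).
Proof. by move=> [_ /(_ i)[fd _]]; exact: fd. Qed.

Lemma Ck_on_partial k D f (i : 'I_n) :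
  Ck_on k.+1 D f -> Ck_on k D (partial i f).
Proof. by move=> [_ /(_ i)[_ fd]]. Qed.

Lemma Ck_on_pred k D f : Ck_on k.+1 D f -> Ck_on k D f.
Proof.
elim: k f => [|k IH] f [fc fd]; first by split.
by split=> // i; have [fdi fi] := fd i; split=> //; exact: IH.
Qed.

Lemma near_open D x : open D -> D x -> \forall y \near x, D y.
Proof. by move=> Do Dx; apply: open_nbhs_nbhs; split. Qed.

Lemma deriv_form1E f x v :
  deriv_form1 f x v = \sum_i v i 0 * partial i f x.
Proof.
by rewrite /deriv_form1 mxE; apply: eq_bigr => i _; rewrite !mxE mulrC.
Qed.

(** The inner sum is the derivative of [partial j f] along [u], so differentiating a form reduces to
    [C1_is_derive] applied to its coefficients. *)
Lemma deriv_form2E f x u v :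
  deriv_form2 f x u v =
  \sum_j v j 0 * \sum_i u i 0 * partial i (partial j f) x.
Proof.
rewrite /deriv_form2 mxE; apply: eq_bigr => j _; rewrite !mxE mulrC.
by congr (_ * _); apply: eq_bigr => i _; rewrite !mxE.
Qed.

Lemma deriv_form3E f x u v w :
  deriv_form3 f x u v w =
  \sum_j v j 0 * \sum_k w k 0 *
     \sum_i u i 0 * partial i (partial j (partial k f)) x.
Proof.
rewrite /deriv_form3 exchange_big /=; apply: eq_bigr => j _.
rewrite exchange_big /= mulr_sumr; apply: eq_bigr => k _.
rewrite !mulr_sumr; apply: eq_bigr => i _; ring.
Qed.

(** [v] is expanded in the standard basis, and [is_derive_addr] adds one coordinate direction at a
    time, by induction on the list of indices. *)
Lemma C1_is_derive D f x v : open D -> Ck_on 1 D f -> D x ->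
  is_derive x v f (deriv_form1 f x v).
Proof.
move=> Do f1 Dx; rewrite deriv_form1E.
have Ev : v = \sum_i v i 0 *: delta_mx i 0.
  rewrite [LHS]matrix_sum_delta; apply: eq_bigr => i _.
  by rewrite big_ord1.
rewrite [X in is_derive _ X](Ev).
elim: (index_enum _) => [|i l IH]; first by rewrite !big_nil; exact: is_derive0.
rewrite !big_cons addrC [X in is_derive _ _ _ X]addrC.
apply: (is_derive_addr _ IH).
  apply: filterS (near_open Do Dx) => y Dy; exact: Ck_on_derivable f1 Dy.
exact: Ck_on_continuous (Ck_on_partial i f1) Dx.
Qed.

Lemma is_derive_big (I : Type) (r : seq I) (h : I -> 'cV[R]_n -> R)
    (dh c : I -> R) x v :
  (forall i, is_derive x v (h i) (dh i)) ->
  is_derive x v (fun y => \sum_(i <- r) c i * h i y) (\sum_(i <- r) c i * dh i).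
Proof.
move=> hd; elim: r => [|i r IH].
  under eq_fun do rewrite big_nil; rewrite big_nil; exact: is_derive_cst.
under eq_fun do rewrite big_cons; rewrite big_cons.
by apply: is_deriveD; apply: is_deriveZ; exact: hd.
Qed.

Lemma is_derive_form1 D f x u v : open D -> Ck_on 2 D f -> D x ->
  is_derive x u (fun y => deriv_form1 f y v) (deriv_form2 f x u v).
Proof.
move=> Do f2 Dx; rewrite deriv_form2E; under eq_fun do rewrite deriv_form1E.
apply: is_derive_big => j; rewrite -deriv_form1E.
exact: C1_is_derive Do (Ck_on_partial j f2) Dx.
Qed.

Lemma is_derive_form2 D f x u v w : open D -> Ck_on 3 D f -> D x ->
  is_derive x u (fun y => deriv_form2 f y v w) (deriv_form3 f x u v w).
Proof.
move=> Do f3 Dx; rewrite deriv_form3E.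
(* The sum carrying [v] is outermost in [deriv_form3E] but inner in [deriv_form2E]; after the
   exchange both nest alike and [is_derive_big] applies twice. *)
under eq_bigr do rewrite mulr_sumr; rewrite exchange_big /=.
under eq_fun do rewrite deriv_form2E.
under eq_bigr => k _ do under eq_bigr do rewrite mulrCA.
under eq_bigr => k _ do rewrite -mulr_sumr.
apply: is_derive_big => k; apply: is_derive_big => j; rewrite -deriv_form1E.
exact: C1_is_derive Do (Ck_on_partial j (Ck_on_partial k f3)) Dx.
Qed.

Lemma C2_hessian_sym D f x : open D -> Ck_on 2 D f -> D x ->
  (hessian f x)^T = hessian f x.
Proof.
move=> Do f2 Dx; apply/matrixP => i j; rewrite !mxE.
have Dn := near_open Do Dx.
apply: derive_comm.
- apply: filterS Dn => y Dy; exact: Ck_on_derivable f2 Dy.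
- apply: filterS Dn => y Dy; exact: Ck_on_derivable f2 Dy.
- apply: filterS Dn => y Dy; exact: Ck_on_derivable (Ck_on_partial i f2) Dy.
- apply: filterS Dn => y Dy; exact: Ck_on_derivable (Ck_on_partial j f2) Dy.
- exact: Ck_on_continuous (Ck_on_partial j (Ck_on_partial i f2)) Dx.
- exact: Ck_on_continuous (Ck_on_partial i (Ck_on_partial j f2)) Dx.
Qed.

(** On an open set, agreement at a point extends to a neighbourhood, so continuity and partial
    derivatives carry over from [f] to [g]. *)
Lemma Ck_on_ext k D f g : open D -> (forall x, D x -> f x = g x) ->
  Ck_on k D f -> Ck_on k D g.
Proof.
move=> Do; elim: k f g => [|k IH] f g fg [fc fd].
all: have fgn x : D x -> \forall y \near x, f y = g y
  by move=> Dx; apply: filterS (near_open Do Dx) => y /fg.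
all: have gc x : D x -> {for x, continuous g}
  by move=> Dx; change (g @ x --> g x); rewrite -(fg x Dx);
     exact: cvg_trans (near_eq_cvg (fgn x Dx)) (fc x Dx).
  by split.
split=> // i.
split=> [x Dx|].
  apply: near_eq_derivable (fgn _ Dx) _; exact: (fd i).1.
apply: IH (fd i).2 => x Dx; apply: near_eq_derive; exact: fgn.
Qed.

(** The induction step of the closure properties below: the partial derivatives may be replaced by
    explicit formulas valid on [D] only. *)
Lemma Ck_onS k D f (df : 'I_n -> 'cV[R]_n -> R) : open D ->
  (forall x, D x -> {for x, continuous f}) ->
  (forall i x, D x -> is_derive x (delta_mx i 0) f (df i x)) ->
  (forall i, Ck_on k D (df i)) -> Ck_on k.+1 D f.
Proof.
move=> Do fc fd dfk; split=> // i; split=> [x /(fd i)[]//|].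
by apply: Ck_on_ext (dfk i) => // x /(fd i)[_ <-].
Qed.

Lemma Ck_on_cst k D (c : R) : open D -> Ck_on k D (cst c).
Proof.
move=> Do; elim: k c => [|k IH] c.
  by split=> // x _; exact: cst_continuous.
apply: (Ck_onS (df := fun _ => cst 0) Do) => [x _|i].
- exact: cst_continuous.
- exact: IH.
Qed.

Lemma Ck_on_coord k D (i : 'I_n) : open D -> Ck_on k D (fun x => x i 0).
Proof.
move=> Do; case: k => [|k]; first by split=> // x _; exact: coord_continuous.
apply: (Ck_onS (df := fun j => cst ((delta_mx j 0 : 'cV[R]_n) i 0)) Do).
- move=> x _; exact: coord_continuous.
- move=> j x _; apply/is_derive_line0P.
  set d := (delta_mx j 0 : 'cV[R]_n) i 0.
  have -> : (fun r : R => (x + r *: (delta_mx j 0 : 'cV[R]_n)) i 0) =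
            cst (x i 0) + d *: (id : R -> R).
    by apply/funext => r; rewrite mxE [X in _ + X]mxE mulrC.
  apply: (is_derive_eq (is_deriveD (is_derive_cst (x i 0) (0 : R) 1)
    (is_deriveZ d (is_derive_id (0 : R) 1)))).
  by rewrite add0r [LHS]mulr1.
- move=> j; exact: Ck_on_cst.
Qed.

Lemma Ck_onD k D f g : open D -> Ck_on k D f -> Ck_on k D g ->
  Ck_on k D (fun x => f x + g x).
Proof.
move=> Do; elim: k f g => [|k IH] f g fk gk.
  split=> // x Dx.
  exact: (cvgD (Ck_on_continuous fk Dx) (Ck_on_continuous gk Dx)).
apply: (Ck_onS (df := fun i x => partial i f x + partial i g x) Do).
- move=> x Dx; exact: (cvgD (Ck_on_continuous fk Dx) (Ck_on_continuous gk Dx)).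
- move=> i x Dx; apply: is_deriveD; apply: derivableP.
    exact: Ck_on_derivable fk Dx.
  exact: Ck_on_derivable gk Dx.
- by move=> i; apply: IH; exact: Ck_on_partial.
Qed.

Lemma Ck_onM k D f g : open D -> Ck_on k D f -> Ck_on k D g ->
  Ck_on k D (fun x => f x * g x).
Proof.
move=> Do; elim: k f g => [|k IH] f g fk gk.
  split=> // x Dx.
  exact: (cvgM (Ck_on_continuous fk Dx) (Ck_on_continuous gk Dx)).
apply: (Ck_onS (df := fun i x => f x * partial i g x + g x * partial i f x) Do).
- move=> x Dx; exact: (cvgM (Ck_on_continuous fk Dx) (Ck_on_continuous gk Dx)).
- move=> i x Dx; apply: is_deriveM; apply: derivableP.
    exact: Ck_on_derivable fk Dx.
  exact: Ck_on_derivable gk Dx.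
- by move=> i; apply: Ck_onD => //; apply: IH;
    do [exact: Ck_on_partial | exact: Ck_on_pred].
Qed.

Lemma Ck_on_sum k D (I : Type) (r : seq I) (h : I -> 'cV[R]_n -> R) : open D ->
  (forall i, Ck_on k D (h i)) -> Ck_on k D (fun x => \sum_(i <- r) h i x).
Proof.
move=> Do hk; elim: r => [|i r IH].
  by under eq_fun do rewrite big_nil; exact: Ck_on_cst.
by under eq_fun do rewrite big_cons; exact: Ck_onD.
Qed.

Lemma Ck_onV k D f : open D -> (forall x, D x -> f x != 0) ->
  Ck_on k D f -> Ck_on k D (fun x => (f x)^-1).
Proof.
move=> Do f0; elim: k => [|k IH] fk.
  split=> // x Dx; exact: (cvgV (f0 x Dx) (Ck_on_continuous fk Dx)).
(* The derivative is written as a product of copies of the inverse itself, so the induction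
   hypothesis and [Ck_onM] close the goal. *)
apply: (Ck_onS
  (df := fun i x => (cst (-1) x * ((f x)^-1 * (f x)^-1)) * partial i f x) Do).
- move=> x Dx; exact: (cvgV (f0 x Dx) (Ck_on_continuous fk Dx)).
- move=> i x Dx; apply/is_derive_line0P.
  have /is_derive_line0P fd := derivableP (Ck_on_derivable fk Dx (i := i)).
  have fx0 : f (x + (0 : R) *: delta_mx i 0) != 0.
    by rewrite scale0r addr0; exact: f0.
  apply: (is_derive_eq (is_deriveV fx0 fd)).
  by rewrite scale0r addr0 /cst mulN1r -invfM -expr2.
- move=> i; apply: Ck_onM => //; last exact: (Ck_on_partial i fk).
  apply: Ck_onM => //; first exact: Ck_on_cst.
  by apply: Ck_onM => //; apply: IH; exact: Ck_on_pred.
Qed.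

Lemma Ck_on_ln k D f : open D -> (forall x, D x -> 0 < f x) ->
  Ck_on k D f -> Ck_on k D (fun x => ln (f x)).
Proof.
move=> Do f0; case: k => [|k] fk.
  split=> // x Dx; apply: continuous_comp;
    first exact: (Ck_on_continuous fk Dx).
  exact: continuous_ln (f0 _ Dx).
apply: (Ck_onS (df := fun i x => (f x)^-1 * partial i f x) Do).
- move=> x Dx; apply: continuous_comp; first exact: (Ck_on_continuous fk Dx).
  exact: continuous_ln (f0 _ Dx).
- move=> i x Dx; apply/is_derive_line0P.
  have /is_derive_line0P fd := derivableP (Ck_on_derivable fk Dx (i := i)).
  have fx0 : 0 < f (x + (0 : R) *: delta_mx i 0).
    by rewrite scale0r addr0; exact: f0.
  apply: (is_derive_eq (is_derive1_comp (is_derive1_ln fx0) fd)).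
  by rewrite scale0r addr0.
- move=> i; apply: Ck_onM => //; last exact: (Ck_on_partial i fk).
  apply: Ck_onV => //; last exact: Ck_on_pred.
  by move=> x /f0/lt0r_neq0.
Qed.

End Ck_basics.

(** * The scalar inequality *)

Lemma powR_3half (R : realType) (x : R) : 0 <= x ->
  x `^ (3 / 2) = Num.sqrt x ^+ 3.
Proof.
move=> x0; rewrite mulrC powRrM powR12_sqrt //.
by rewrite powR_mulrn // sqrtr_ge0.
Qed.

(** Here [m], [b] and [d] stand for sqrt (nu - 1), |b| and sqrt Delta, so [m ^+ 2 + 1] is nu and
    [(m ^+ 2 - 1) / m] is gamma. The left side is the square of half the bound on |T - 6 b Delta - 2
    b^3| given by the triangle inequality; squaring makes the claim rational. *)
Lemma cubic_bound (R : realFieldType) (m b d : R) :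
  1 <= m -> 0 <= b -> 0 <= d ->
  ((m ^+ 2 - 1) / m * d ^+ 3 + 3 * b * d ^+ 2 + b ^+ 3) ^+ 2
  <= (m ^+ 2 + 1) * (b ^+ 2 + d ^+ 2) ^+ 3.
Proof.
move=> m1 b0 d0; have m0 : 0 < m by apply: lt_le_trans m1.
have c0 : 0 <= m * b by rewrite mulr_ge0 // ltW.
have M1 : 1 <= m ^+ 2 by rewrite exprn_ege1.
rewrite -subr_ge0; set X := _ - _.
(* The difference vanishes to second order at [m * b = d]. *)
have -> : X = (m * b - d) ^+ 2 * ((m * b) ^+ 4 + 2 * (m * b) ^+ 3 * d
    + 3 * m ^+ 2 * (m * b) ^+ 2 * d ^+ 2 + 4 * m ^+ 2 * (m * b) * d ^+ 3
    + m ^+ 2 * (3 * m ^+ 2 - 1) * d ^+ 4) / m ^+ 4.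
  by rewrite /X; field; rewrite gt_eqF.
have M3 : 0 <= 3 * m ^+ 2 - 1 by lra.
rewrite mulr_ge0 ?invr_ge0 ?exprn_ge0 ?(ltW m0) // mulr_ge0 ?sqr_ge0 //.
by rewrite !addr_ge0 // ?mulr_ge0 // ?exprn_ge0 // ltW.
Qed.

(** Since nu^(3/2) = nu sqrt nu, one factor nu cancels on both sides. *)
Lemma scaled_bound (R : realType) (nu Delta b X : R) :
  0 < nu -> 0 <= Delta ->
  (`|nu * X| <= 2 * (nu * (b ^+ 2 + Delta)) `^ (3 / 2)) =
  (`|X| <= 2 * Num.sqrt nu * Num.sqrt (b ^+ 2 + Delta) ^+ 3).
Proof.
move=> nu0 Delta0.
have B0 : 0 <= b ^+ 2 + Delta by rewrite addr_ge0 ?sqr_ge0.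
rewrite powR_3half ?mulr_ge0 ?(ltW nu0) // sqrtrM ?(ltW nu0) //.
rewrite normrM (gtr0_norm nu0) -[RHS](ler_pM2l nu0); congr (_ <= _).
rewrite -[X in X * (2 * _ * _)](sqr_sqrtr (ltW nu0)); ring.
Qed.

Lemma self_concordance_scalar (R : realType) (nu Delta T : R) :
  2 <= nu -> 0 <= Delta ->
  `|T| <= 2 * ((nu - 2) / Num.sqrt (nu - 1)) * Delta `^ (3 / 2) <->
  forall b, `|nu * (T - 6 * b * Delta - 2 * b ^+ 3)|
            <= 2 * (nu * (b ^+ 2 + Delta)) `^ (3 / 2).
Proof.
move=> nu2 Delta0; rewrite powR_3half //.
have nu0 : 0 < nu by lra.
have nu1 : 1 <= nu - 1 by lra.
have nu10 : 0 <= nu - 1 by lra.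
have m1 : 1 <= Num.sqrt (nu - 1) by rewrite -[X in X <= _]sqrtr1 ler_sqrt.
have m0 : 0 < Num.sqrt (nu - 1) by exact: lt_le_trans m1.
have m2 := sqr_sqrtr nu10; have N2 := sqr_sqrtr (ltW nu0).
have N0 : 0 < Num.sqrt nu by rewrite sqrtr_gt0.
have d0 := sqrtr_ge0 Delta; have d2 := sqr_sqrtr Delta0.
rewrite (_ : nu - 2 = Num.sqrt (nu - 1) ^+ 2 - 1); last by rewrite m2; ring.
have {}N2 : Num.sqrt nu ^+ 2 = Num.sqrt (nu - 1) ^+ 2 + 1.
  by rewrite m2 N2; ring.
(* The square roots become variables [m], [N], [d] tied by [N ^+ 2 = m ^+ 2 + 1] and
   [d ^+ 2 = Delta], leaving algebra for [ring], [field] and [lra]. *)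
clear m2 nu10 nu1; move: (Num.sqrt (nu - 1)) m1 m0 N2 => m m1 m0 N2.
have {}scaled_bound b X := @scaled_bound R nu Delta b X nu0 Delta0.
move: (Num.sqrt nu) N2 N0 scaled_bound => N N2 N0 scaled_bound.
move: (Num.sqrt Delta) d0 d2 => d d0 d2.
split=> [HT b|H].
  rewrite scaled_bound.
  have B0 : 0 <= b ^+ 2 + Delta by rewrite addr_ge0 ?sqr_ge0.
  have e2 : Num.sqrt (b ^+ 2 + Delta) ^+ 2 = `|b| ^+ 2 + d ^+ 2.
    by rewrite sqr_sqrtr // d2 real_normK // num_real.
  move: (Num.sqrt (b ^+ 2 + Delta)) (sqrtr_ge0 (b ^+ 2 + Delta)) e2 => e e0 e2.
  have := cubic_bound m1 (normr_ge0 b) d0; rewrite -e2 -N2.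
  have -> : N ^+ 2 * (e ^+ 2) ^+ 3 = (N * e ^+ 3) ^+ 2 by ring.
  rewrite ler_sqr ?nnegrE; first last.
  - by rewrite mulr_ge0 ?exprn_ge0 // ltW.
  - rewrite !addr_ge0 ?mulr_ge0 ?exprn_ge0 // ?invr_ge0 ?(ltW m0) //.
    by rewrite subr_ge0 exprn_ege1.
  move=> Hb; apply: (le_trans (ler_normB _ _)).
  have := ler_normB T (6 * b * Delta).
  have -> : `|6 * b * Delta| = 6 * `|b| * d ^+ 2.
    by rewrite -d2 normrM (ger0_norm (sqr_ge0 d)) normrM normr_nat.
  have -> : `|2 * b ^+ 3| = 2 * `|b| ^+ 3 by rewrite normrM normrX normr_nat.
  move: HT Hb; set g := (_ / m); clear; lra.
have {}H b : `|T - 6 * b * Delta - 2 * b ^+ 3|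
    <= 2 * N * Num.sqrt (b ^+ 2 + Delta) ^+ 3 
  by rewrite -scaled_bound.
have mn0 : m != 0 by rewrite gt_eqF.
(* At the extremal [b], [b ^+ 2 + Delta] is the perfect square [(N * d / m) ^+ 2], so the root
   disappears. *)
have sq (b : R) : b ^+ 2 = (d / m) ^+ 2 ->
    2 * N * Num.sqrt (b ^+ 2 + Delta) ^+ 3 =
    2 * (m ^+ 2 + 1) ^+ 2 / m ^+ 3 * d ^+ 3.
  move=> ->; have -> : (d / m) ^+ 2 + Delta = (N * d / m) ^+ 2.
    by rewrite -d2 !exprMn N2 exprVn; field.
  rewrite sqrtr_sqr ger0_norm; last by rewrite divr_ge0 ?mulr_ge0 // ltW.
  rewrite -N2; field; exact: mn0.
(* The choice [b = d / m] yields the lower bound on [T], and [b = - (d / m)] the upper one. *)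
have := H (d / m); rewrite sq // ler_norml => /andP[H1 _].
have := H (- (d / m)); rewrite sq ?sqrrN // ler_norml => /andP[_ H2].
have E : 2 * ((m ^+ 2 - 1) / m) * d ^+ 3 =
    2 * (m ^+ 2 + 1) ^+ 2 / m ^+ 3 * d ^+ 3 - 6 * (d / m) * Delta
    - 2 * (d / m) ^+ 3 by rewrite -d2; field; exact: mn0.
have E3 : (- (d / m)) ^+ 3 = - (d / m) ^+ 3 by ring.
by rewrite ler_norml E; apply/andP; split; lra.
Qed.

(** * The conic extension and its barrier *)

(** The central projection of the cone onto its slice t = 1. *)
Definition dehomog {R : realType} {n : nat} (z : 'cV[R]_(1 + n)) : 'cV[R]_n :=
  (cone_t z)^-1 *: cone_x z.

(* The direction in which [dehomog] moves when [z] moves along [h]. *)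
Definition dehomog_dir {R : realType} {n : nat} (z h : 'cV[R]_(1 + n)) :
    'cV[R]_n :=
  (cone_t z)^-1 *: (cone_x h - cone_t h *: dehomog z).

Section cone.
Context {R : realType} {n : nat}.
Implicit Types (D : set 'cV[R]_n) (f g : 'cV[R]_n -> R).
Implicit Types (z h : 'cV[R]_(1 + n)).

Lemma cone_tE z : cone_t z = z (lshift n 0) 0.
Proof. by rewrite /cone_t mxE. Qed.

Lemma cone_t_line z h (s : R) : cone_t (z + s *: h) = cone_t z + s * cone_t h.
Proof. by rewrite !cone_tE !mxE. Qed.

Lemma cone_x_line z h (s : R) : cone_x (z + s *: h) = cone_x z + s *: cone_x h.
Proof. by apply/colP => i; rewrite !mxE. Qed.

Lemma cone_t_continuous : continuous (@cone_t R n).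
Proof.
move=> z; rewrite (_ : @cone_t R n = fun z => z (lshift n 0) 0).
  exact: coord_continuous.
by apply/funext => ?; exact: cone_tE.
Qed.

Lemma cone_x_continuous : continuous (@cone_x R n).
Proof.
move=> z A /nbhs_ballP[e e0 eA]; apply/nbhs_ballP; exists e => // z' [_ zz'].
by apply: eA; split=> // i j; rewrite /cone_x !mxE; exact: zz'.
Qed.

Lemma dehomog_continuous z : cone_t z != 0 -> {for z, continuous dehomog}.
Proof.
move=> z0; have c1 := cvgV z0 (@cone_t_continuous z).
exact: (cvgZ (c1 _) (@cone_x_continuous z)).
Qed.

Lemma conic_extension_open D : open D -> open (conic_extension D).
Proof.
move=> Do; rewrite openE => z [z0 Dz]; rewrite /interior /=.
apply: filterI.
  exact: (@cone_t_continuous z _ (open_nbhs_nbhs (conj (@open_gt R 0) z0))).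
exact: (@dehomog_continuous z (lt0r_neq0 z0) _ (open_nbhs_nbhs (conj Do Dz))).
Qed.

Lemma dehomog_dirE z h i :
  dehomog_dir z h i 0 = (cone_t z)^-1 *
    (cone_x h i 0 - cone_t h * ((cone_t z)^-1 * z (rshift 1 i) 0)).
Proof. by rewrite /dehomog_dir /dehomog !mxE. Qed.

(** A central projection maps lines to lines, up to a projective change of the parameter. *)
Lemma dehomog_line z h (s : R) : cone_t z != 0 -> cone_t (z + s *: h) != 0 ->
  dehomog (z + s *: h) =
  dehomog z + (s / (1 + cone_t h / cone_t z * s)) *: dehomog_dir z h.
Proof.
rewrite cone_t_line => t0 ts0.
apply/colP => i; rewrite /dehomog_dir /dehomog cone_t_line cone_x_line.
rewrite !mxE; set t := cone_t z in t0 ts0 *; set u := cone_t h in ts0 *.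
field; rewrite t0 /= mulrC; exact: ts0.
Qed.

End cone.

(** * One-variable derivative rules *)

Section real_derivatives.
Context {R : realType}.
Implicit Types (f g : R -> R) (s c : R).

(** This rule and the next two are phrased for pointwise expressions, so that derivatives of large
    formulas can be assembled as explicit terms. *)
Lemma is_derive1_fun_add f g s df dg :
  is_derive s (1 : R) f df -> is_derive s (1 : R) g dg ->
  is_derive s (1 : R) (fun r => f r + g r) (df + dg).
Proof. exact: is_deriveD. Qed.

Lemma is_derive1_fun_mul f g s df dg :
  is_derive s (1 : R) f df -> is_derive s (1 : R) g dg ->
  is_derive s (1 : R) (fun r => f r * g r) (f s * dg + g s * df).
Proof. exact: is_deriveM. Qed.

Lemma is_derive1_fun_scale f s c df :
  is_derive s (1 : R) f df -> is_derive s (1 : R) (fun r => c * f r) (c * df).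
Proof. exact: is_deriveZ. Qed.

Lemma is_derive1_inv_affine (a s : R) : 1 + a * s != 0 ->
  is_derive s (1 : R) (fun r => (1 + a * r)^-1) (- a * (1 + a * s)^-1 ^+ 2).
Proof.
move=> u0.
have ud : is_derive s (1 : R) (fun r => 1 + a * r) a.
  have -> : (fun r : R => 1 + a * r) = cst 1 + a *: (id : R -> R) by [].
  apply: (is_derive_eq (is_deriveD (is_derive_cst (1 : R) s 1)
    (is_deriveZ a (is_derive_id s 1)))).
  by rewrite add0r [LHS]mulr1.
apply: (is_derive_eq (@is_deriveV R (fun r => 1 + a * r) s a 1 u0 ud)).
by rewrite exprVn mulNr [LHS]mulrC mulrN.
Qed.

Lemma is_derive1_projective (a s : R) : 1 + a * s != 0 ->
  is_derive s (1 : R) (fun r => r / (1 + a * r)) ((1 + a * s)^-1 ^+ 2).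
Proof.
move=> u0; apply: (is_derive_eq (is_derive1_fun_mul (is_derive_id s 1)
  (is_derive1_inv_affine u0))).
by rewrite mulr1; field.
Qed.

End real_derivatives.

(** * Smoothness of the barrier and its derivatives along lines *)

Section barrier.
Context {R : realType} {n : nat}.
Implicit Types (D : set 'cV[R]_n) (f g : 'cV[R]_n -> R).
Implicit Types (z h : 'cV[R]_(1 + n)).

Lemma line_open (V : normedModType R) (A : set V) (x v : V) :
  open A -> open [set s : R | A (x + s *: v)].
Proof.
move=> Ao; apply: (@open_comp _ _ (fun s : R => x + s *: v) A) => // s _.
have c : (fun r : R => r *: v) @ s --> s *: v by exact: scalel_continuous.
exact: (cvgD (cvg_cst x) c).
Qed.

(** Along the line, [g \o dehomog] is [g] on a line in [D] with parameter s / (1 + a s), whose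
    derivative at 0 is 1. *)
Lemma is_derive_dehomog D g z h : open D -> Ck_on 1 D g ->
  conic_extension D z ->
  is_derive z h (g \o dehomog) (deriv_form1 g (dehomog z) (dehomog_dir z h)).
Proof.
move=> Do g1 Kz; have [t0 Dz] := Kz; apply/is_derive_line0P.
have u0 : 1 + cone_t h / cone_t z * 0 != 0 by rewrite mulr0 addr0 oner_neq0.
have /is_derive_line0P gd := C1_is_derive (dehomog_dir z h) Do g1 Dz.
have H0 : is_derive (0 / (1 + cone_t h / cone_t z * 0)) (1 : R)
   (fun r => g (dehomog z + r *: dehomog_dir z h))
   (deriv_form1 g (dehomog z) (dehomog_dir z h)) by rewrite mul0r.
have H1 := is_derive1_comp (g := fun r => r / (1 + cone_t h / cone_t z * r))
  H0 (is_derive1_projective u0).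
rewrite mulr0 addr0 invr1 expr1n mulr1 in H1.
(* [dehomog_line] requires a nonzero first coordinate, which holds for [s] near 0 because the cone
   is open. *)
apply: near_eq_is_derive H1.
have Ko : open [set s : R | conic_extension D (z + s *: h)].
  exact: (line_open (conic_extension_open Do)).
have K0 : [set s : R | conic_extension D (z + s *: h)] 0.
  by rewrite /= scale0r addr0.
apply: filterS (open_nbhs_nbhs (conj Ko K0)) => s [/lt0r_neq0 ts _] /=.
by rewrite dehomog_line // lt0r_neq0.
Qed.

Lemma Ck_on_cone_t k (A : set 'cV[R]_(1 + n)) :
  open A -> Ck_on k A (@cone_t R n).
Proof.
move=> Ao; rewrite (_ : @cone_t R n = fun z => z (lshift n 0) 0).
  exact: Ck_on_coord.
by apply/funext => ?; exact: cone_tE.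
Qed.

(** By induction on [k]: each partial derivative is a sum of functions rational in [z] times
    [partial j g \o dehomog], to which the induction hypothesis applies. *)
Lemma Ck_on_dehomog k D g : open D -> Ck_on k D g ->
  Ck_on k (conic_extension D) (g \o dehomog).
Proof.
move=> Do; have Ko := conic_extension_open Do.
have gc k' g' : Ck_on k' D g' -> forall z, conic_extension D z ->
    {for z, continuous (g' \o dehomog)}.
  move=> gk z [t0 Dz]; apply: continuous_comp.
    exact: (dehomog_continuous (lt0r_neq0 t0)).
  exact: (Ck_on_continuous gk Dz).
elim: k g => [|k IH] g gk; first by split=> //; exact: (gc _ _ gk).
have g1 : Ck_on 1 D g.
  have [fc fd] := gk; split=> // i; have [fdi fk] := fd i; split=> //.
  by split=> // x Dx; exact: (Ck_on_continuous fk Dx).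
pose dg (i : 'I_(1 + n)) z :=
  deriv_form1 g (dehomog z) (dehomog_dir z (delta_mx i 0)).
apply: (Ck_onS (df := dg) Ko (gc _ _ gk)) => [i z Kz|i].
  exact: (is_derive_dehomog _ Do g1 Kz).
pose e : 'cV[R]_(1 + n) := delta_mx i 0.
have tV : Ck_on k (conic_extension D) (fun z => (cone_t z)^-1).
  apply: (Ck_onV Ko); last exact: Ck_on_cone_t.
  by move=> z [t0 _]; exact: lt0r_neq0.
apply: (@Ck_on_ext _ _ _ _ (fun z => \sum_j ((cone_t z)^-1 *
    (cst (cone_x e j 0) z + cst (- cone_t e) z *
       ((cone_t z)^-1 * z (rshift 1 j) 0))) *
    (partial j g \o dehomog) z)) => //.
  move=> z Kz; rewrite /dg deriv_form1E; apply: eq_bigr => j _.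
  by rewrite dehomog_dirE /cst mulNr.
apply: (Ck_on_sum _ Ko) => j; apply: (Ck_onM Ko); last first.
  exact: (IH _ (Ck_on_partial j gk)).
apply: (Ck_onM Ko tV); apply: (Ck_onD Ko); first exact: Ck_on_cst.
apply: (Ck_onM Ko); first exact: Ck_on_cst.
by apply: (Ck_onM Ko tV); exact: Ck_on_coord.
Qed.

Lemma Ck_on_conic_barrier k D f nu : open D -> Ck_on k D f ->
  Ck_on k (conic_extension D) (conic_barrier nu f).
Proof.
move=> Do fk; have Ko := conic_extension_open Do.
apply: (@Ck_on_ext _ _ _ _
  (fun z => cst nu z * (cst (-1) z * ln (cone_t z) + (f \o dehomog) z))) => //.
  by move=> z _; rewrite /cst mulN1r.
apply: (Ck_onM Ko); first exact: Ck_on_cst.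
apply: (Ck_onD Ko); last exact: Ck_on_dehomog.
apply: (Ck_onM Ko); first exact: Ck_on_cst.
by apply: (Ck_on_ln Ko) => [z []//|]; exact: Ck_on_cone_t.
Qed.

Lemma is_derive1_eq_on (I : set R) (phi psi : R -> R) (s d d' : R) :
  open I -> I s -> (forall x, I x -> phi x = psi x) ->
  is_derive s (1 : R) phi d -> is_derive s (1 : R) psi d' -> d = d'.
Proof.
move=> Io Is eqI dphi [_ <-]; apply/esym.
have [_ //] : is_derive s (1 : R) psi d.
by apply: near_eq_is_derive dphi; apply: filterS (open_nbhs_nbhs (conj Io Is)).
Qed.

(** The restriction of [F] to the line is differentiated three times. The first two identities are
    proved at every [s] in the open set [I], not only at 0, so that each can be differentiated again
    through [is_derive1_eq_on]. *)
Lemma conic_barrier_forms D f nu z h : open D -> Ck_on 3 D f ->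
  conic_extension D z ->
  let y := dehomog z in
  let w := dehomog_dir z h in
  let p := deriv_form1 f y w in
  let Delta := deriv_form2 f y w w - p ^+ 2 in
  let T := deriv_form3 f y w w w - 6 * deriv_form2 f y w w * p + 4 * p ^+ 3 in
  let b := cone_t h / cone_t z - p in
  deriv_form2 (conic_barrier nu f) z h h = nu * (b ^+ 2 + Delta) /\
  deriv_form3 (conic_barrier nu f) z h h h =
    nu * (T - 6 * b * Delta - 2 * b ^+ 3).
Proof.
move=> Do f3 Kz y w.
have Ko := conic_extension_open Do.
have F3 := Ck_on_conic_barrier nu Do f3.
have f2 := Ck_on_pred f3; have f1 := Ck_on_pred f2.
have F2 := Ck_on_pred F3; have F1 := Ck_on_pred F2.
have t0 : 0 < cone_t z by case: Kz.
set F := conic_barrier nu f in F1 F2 F3 *; set a := cone_t h / cone_t z.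
pose I := [set s : R | conic_extension D (z + s *: h)].
have Io : open I by exact: (line_open Ko).
have I0 : I 0 by rewrite /I /= scale0r addr0.
pose v (s : R) := (1 + a * s)^-1.
pose r (s : R) := s / (1 + a * s).
pose P (s : R) := deriv_form1 f (y + s *: w) w.
pose Q (s : R) := deriv_form2 f (y + s *: w) w w.
pose C (s : R) := deriv_form3 f (y + s *: w) w w w.
have uE s : cone_t (z + s *: h) = cone_t z * (1 + a * s).
  by rewrite cone_t_line /a; field; rewrite lt0r_neq0.
have u0 s : I s -> 1 + a * s != 0.
  by move=> [ts _]; move: ts; rewrite uE pmulr_rgt0 // => /lt0r_neq0.
have yE s : I s -> dehomog (z + s *: h) = y + r s *: w.
  by move=> [/lt0r_neq0 ts _]; rewrite dehomog_line // lt0r_neq0.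
have Dr s : I s -> D (y + r s *: w) by move=> Is; rewrite -yE //; case: Is.
have dv s : I s -> is_derive s (1 : R) v (- a * v s ^+ 2).
  by move=> Is; exact: (is_derive1_inv_affine (u0 s Is)).
(* The derivative of [r] is [v ^+ 2], so each differentiation through [r] brings out this factor. *)
have dr (G : R -> R) s d : I s -> is_derive (r s) (1 : R) G d ->
    is_derive s (1 : R) (fun x => G (r x)) (d * v s ^+ 2).
  move=> Is Gd; exact: (is_derive1_comp Gd (is_derive1_projective (u0 s Is))).
have dP s : I s -> is_derive s (1 : R) (fun x => P (r x)) (Q (r s) * v s ^+ 2).
  move=> Is; apply: (dr _ _ _ Is).
  have /is_derive_lineP := is_derive_form1 w w Do f2 (Dr s Is); exact.
have dQ s : I s -> is_derive s (1 : R) (fun x => Q (r x)) (C (r s) * v s ^+ 2).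
  move=> Is; apply: (dr _ _ _ Is).
  have /is_derive_lineP := is_derive_form2 w w w Do f3 (Dr s Is); exact.
(* The restriction of [F] to the line and its first two derivatives. Powers of [v] are spelled out
   as products to fit [is_derive1_fun_mul]. *)
pose psi0 (s : R) := nu * (-1 * ln (cone_t z * (1 + a * s)) + f (y + r s *: w)).
pose psi1 (s : R) := nu * (- a * v s + P (r s) * (v s * v s)).
pose psi2 (s : R) := nu * (a ^+ 2 * (v s * v s)
  + (Q (r s) * ((v s * v s) * (v s * v s))
     + (-2 * a) * (P (r s) * (v s * (v s * v s))))).
have d0 s : I s -> is_derive s (1 : R) psi0 (psi1 s).
  move=> Is.
  have fd : is_derive s (1 : R) (fun x => f (y + r x *: w))
      (P (r s) * v s ^+ 2).
    apply: (dr (fun x => f (y + x *: w)) _ _ Is).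
    have /is_derive_lineP := C1_is_derive w Do f1 (Dr s Is); exact.
  have ud : is_derive s (1 : R) (fun x => cone_t z * (1 + a * x))
      (cone_t z * a).
    apply: is_derive1_fun_scale; apply: (is_derive_eq (is_derive1_fun_add
      (is_derive_cst (1 : R) s 1) (is_derive1_fun_scale a (is_derive_id s 1)))).
    by rewrite add0r mulr1.
  have tu0 : 0 < cone_t z * (1 + a * s) by rewrite -uE; case: Is.
  have ld : is_derive s (1 : R) (fun x => ln (cone_t z * (1 + a * x)))
      ((cone_t z * (1 + a * s))^-1 * (cone_t z * a)).
    exact: (is_derive1_comp (f := @ln R)
      (g := fun x => cone_t z * (1 + a * x)) (is_derive1_ln tu0) ud).
  apply: (is_derive_eq (is_derive1_fun_scale nu (is_derive1_fun_add
    (is_derive1_fun_scale (-1) ld) fd))).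
  by rewrite /psi1 /v; field; rewrite u0 // lt0r_neq0.
have d1 s : I s -> is_derive s (1 : R) psi1 (psi2 s).
  move=> Is; apply: (is_derive_eq (is_derive1_fun_scale nu (is_derive1_fun_add
    (is_derive1_fun_scale (- a) (dv s Is))
    (is_derive1_fun_mul (dP s Is) (is_derive1_fun_mul (dv s Is) (dv s Is)))))).
  by rewrite /psi2; ring.
have E1 s : I s -> deriv_form1 F (z + s *: h) h = psi1 s.
  move=> Is; have /is_derive_lineP dF := C1_is_derive h Ko F1 Is.
  apply: (is_derive1_eq_on Io Is _ dF (d0 s Is)) => x Ix.
  by rewrite /F /conic_barrier -/(dehomog _) yE // uE /psi0 mulN1r.
have E2 s : I s -> deriv_form2 F (z + s *: h) h h = psi2 s.
  move=> Is; have /is_derive_lineP dF := is_derive_form1 h h Ko F2 Is.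
  exact: (is_derive1_eq_on Io Is E1 dF (d1 s Is)).
have v0 : v 0 = 1 by rewrite /v mulr0 addr0 invr1.
have r0 : r 0 = 0 by rewrite /r mul0r.
have P0 : P 0 = deriv_form1 f y w by rewrite /P scale0r addr0.
have Q0 : Q 0 = deriv_form2 f y w w by rewrite /Q scale0r addr0.
have C0 : C 0 = deriv_form3 f y w w w by rewrite /C scale0r addr0.
split.
  have := E2 _ I0; rewrite scale0r addr0 => ->.
  by rewrite /psi2 v0 r0 P0 Q0; ring.
(* The third derivative is needed only at 0, where [v] is 1 and [r] is 0. *)
have /is_derive_lineP dF := is_derive_form2 h h h Ko F3 I0.
have d2 := is_derive1_fun_scale nu (is_derive1_fun_add
  (is_derive1_fun_scale (a ^+ 2) (is_derive1_fun_mul (dv _ I0) (dv _ I0)))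
  (is_derive1_fun_add
    (is_derive1_fun_mul (dQ _ I0)
      (is_derive1_fun_mul (is_derive1_fun_mul (dv _ I0) (dv _ I0))
                          (is_derive1_fun_mul (dv _ I0) (dv _ I0))))
    (is_derive1_fun_scale (-2 * a) (is_derive1_fun_mul (dP _ I0)
      (is_derive1_fun_mul (dv _ I0)
        (is_derive1_fun_mul (dv _ I0) (dv _ I0))))))).
have := is_derive1_eq_on Io I0 E2 dF d2; rewrite scale0r addr0 => ->.
by rewrite v0 r0 P0 Q0 C0; ring.
Qed.

End barrier.

(** * The quadratic form of condition (i) and lifting of directions to the cone *)

Section normalized_hessian.
Context {R : realType} {n : nat}.
Implicit Types (f : 'cV[R]_n -> R) (x w : 'cV[R]_n).

(** Identifies the quadratic form of condition (i) with Delta; the rank-one term is the square of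
    the 1 x 1 matrix [(gradient f x)^T *m w]. *)
Lemma quad_form_hessian_sub_gradient f x w :
  (w^T *m (hessian f x - gradient f x *m (gradient f x)^T) *m w) 0 0 =
  deriv_form2 f x w w - deriv_form1 f x w ^+ 2.
Proof.
have E : w^T *m gradient f x *m ((gradient f x)^T *m w) =
    (deriv_form1 f x w ^+ 2)%:M.
  rewrite -[w^T *m _]trmxK trmx_mul trmxK.
  have -> : (gradient f x)^T *m w = (deriv_form1 f x w)%:M.
    exact: mx11_scalar.
  by rewrite tr_scalar_mx -scalar_mxM expr2.
rewrite mulmxBr mulmxBl mulmxA -(mulmxA _ (gradient f x)^T) E.
by rewrite !mxE eqxx mulr1n /deriv_form2 !mxE.
Qed.

Lemma deriv_form1_0 f x : deriv_form1 f x 0 = 0.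
Proof. by rewrite /deriv_form1 mulmx0 mxE. Qed.

Lemma deriv_form2_0 f x : deriv_form2 f x 0 0 = 0.
Proof. by rewrite /deriv_form2 mulmx0 mxE. Qed.

Lemma cone_eq0 (h : 'cV[R]_(1 + n)) : cone_t h = 0 -> cone_x h = 0 -> h = 0.
Proof.
move=> t0 x0; rewrite -[h]vsubmxK; apply/colP => i.
have -> : usubmx h = 0 by apply/colP => j; rewrite ord1 -/(cone_t h) t0 mxE.
by rewrite -/(cone_x h) x0 col_mx0.
Qed.

(** Every pair [w], [a] is realised on the slice t = 1: the summand [a *: x] compensates the term
    subtracted in [dehomog_dir]. *)
Lemma dehomog_lift x w (a : R) :
  let z := col_mx 1%:M x in let h := col_mx a%:M (w + a *: x) in
  [/\ cone_t z = 1, cone_t h = a, dehomog z = x & dehomog_dir z h = w].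
Proof.
move=> z h.
have zt : cone_t z = 1 by rewrite /cone_t col_mxKu mxE eqxx.
have ht : cone_t h = a by rewrite /cone_t col_mxKu mxE eqxx.
have zx : dehomog z = x by rewrite /dehomog zt invr1 scale1r /cone_x col_mxKd.
split=> //; rewrite /dehomog_dir zx zt ht invr1 scale1r /cone_x col_mxKd.
by rewrite addrK.
Qed.

End normalized_hessian.

(** * The two implications *)

Theorem theorem1p5 (R : realType) (n : nat) (D : set 'cV[R]_n)
  (D_open : open D) (D_convex : convex_set D)
  (f : 'cV[R]_n -> R) (f_C3 : Ck_on 3 D f)
  (nu : R) (nu_ge2 : 2 <= nu) :
  let K := conic_extension D in
  let F := conic_barrier nu f in
  let gamma := (nu - 2) / Num.sqrt (nu - 1) in
  ((forall x, D x ->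
      posdefmx (hessian f x - gradient f x *m (gradient f x)^T)) /\
   (forall x h, D x ->
      `| deriv_form3 f x h h h
         - 6 * deriv_form2 f x h h * deriv_form1 f x h
         + 4 * deriv_form1 f x h ^+ 3 |
      <= 2 * gamma * (deriv_form2 f x h h - deriv_form1 f x h ^+ 2) `^ (3 / 2)))
  <->
  ((forall z, K z -> posdefmx (hessian F z)) /\
   (forall z h, K z ->
      `| deriv_form3 F z h h h | <= 2 * deriv_form2 F z h h `^ (3 / 2))).
Proof.
move=> K F gamma.
have nu0 : 0 < nu by exact: lt_le_trans nu_ge2.
have Ko : open K := conic_extension_open D_open.
have f2 := Ck_on_pred f_C3.
have F2 : Ck_on 2 K F := Ck_on_pred (Ck_on_conic_barrier nu D_open f_C3).
(* Any [w] and [b] arise from some [z] and [h], by lifting with [a = b + p]. The clause on [h = 0]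
   turns a nonzero [w] into a nonzero [h], as strict positivity requires. *)
have lift_barrier x w b : D x -> exists2 z, K z & exists2 h,
    (h = 0 -> w = 0) &
    let p := deriv_form1 f x w in
    let Delta := deriv_form2 f x w w - p ^+ 2 in
    let T := deriv_form3 f x w w w - 6 * deriv_form2 f x w w * p
             + 4 * p ^+ 3 in
    deriv_form2 F z h h = nu * (b ^+ 2 + Delta) /\
    deriv_form3 F z h h h = nu * (T - 6 * b * Delta - 2 * b ^+ 3).
  move=> Dx; pose a := b + deriv_form1 f x w.
  have [] := dehomog_lift x w a; set z := col_mx _ _; set h := col_mx _ _.
  move=> zt ht zx hw.
  have Kz : K z by split; rewrite ?zt ?ltr01 // -zt -/(dehomog z) zx.
  exists z => //; exists h.
    move=> h0; have hx0 : cone_x h = 0 by rewrite h0 /cone_x linear0.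
    have ht0 : cone_t h = 0 by rewrite h0 /cone_t linear0 mxE.
    by rewrite -hw /dehomog_dir hx0 ht0 scale0r subr0 scaler0.
  have [] := conic_barrier_forms nu h D_open f_C3 Kz.
  by rewrite zx hw zt ht divr1 /a addrK.
split=> [[pd sc]|[pd sc]]; split.
- move=> z Kz; split=> [|h h0]; first exact: C2_hessian_sym Ko F2 Kz.
  have [E2 _] := conic_barrier_forms nu h D_open f_C3 Kz.
  have {}E2 : (h^T *m hessian F z *m h) 0 0 = _ := E2.
  rewrite E2 mulr_gt0 //; have [t0 Dy] := Kz.
  (* If [w] is nonzero, Delta is positive. If [w] is 0, then p and Delta vanish and b = a, which is
     nonzero: otherwise both components of [h] would be 0. *)
  have [w0|w0] := eqVneq (dehomog_dir z h) 0; last first.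
    rewrite ltr_wpDl ?sqr_ge0 // -quad_form_hessian_sub_gradient.
    exact: (pd _ Dy).2.
  rewrite w0 deriv_form1_0 deriv_form2_0 expr0n /= !subr0 addr0.
  rewrite lt_neqAle sqr_ge0 andbT eq_sym sqrf_eq0 mulf_neq0 //; last first.
    by rewrite invr_eq0 lt0r_neq0.
  apply: contraNneq h0 => ht0; apply/eqP/cone_eq0 => //.
  move: w0; rewrite /dehomog_dir ht0 scale0r subr0 => /eqP.
  by rewrite scaler_eq0 invr_eq0 (negbTE (lt0r_neq0 t0)) => /eqP.
- move=> z h Kz; have [_ Dy] := Kz.
  have [-> ->] := conic_barrier_forms nu h D_open f_C3 Kz.
  apply: (self_concordance_scalar _ nu_ge2 _).1; last exact: sc.
  rewrite -quad_form_hessian_sub_gradient.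
  have [->|w0] := eqVneq (dehomog_dir z h) 0; first by rewrite mulmx0 mxE.
  by apply: ltW; exact: (pd _ Dy).2.
- move=> x Dx; split=> [|w w0].
    by rewrite linearB /= (C2_hessian_sym D_open f2 Dx) trmx_mul trmxK.
  (* With b = 0 the Hessian form of [F] is nu Delta, so its positivity passes to Delta. *)
  have [z Kz [h hw [E2 _]]] := lift_barrier x w 0 Dx.
  rewrite quad_form_hessian_sub_gradient -(pmulr_rgt0 _ nu0).
  move: E2; rewrite expr0n add0r => <-; apply: (pd _ Kz).2.
  by apply: contraNneq w0 => /hw ->.
- move=> x w Dx.
  apply: (self_concordance_scalar _ nu_ge2 _).2 => [|b].
    (* The scalar lemma needs Delta >= 0, again read off at b = 0; here [h] may vanish. *)
    rewrite -(pmulr_rge0 _ nu0).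
    have [z Kz [h hw [E2 _]]] := lift_barrier x w 0 Dx.
    move: E2; rewrite expr0n add0r => <-.
    have [->|h0] := eqVneq h 0; first by rewrite deriv_form2_0.
    by apply: ltW; exact: (pd _ Kz).2.
  have [z Kz [h _ [<- <-]]] := lift_barrier x w b Dx; exact: sc.
Qed.
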